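(* Let $D \subset \mathbb{N} = \{1, 2, 3, \ldots\}$ be a finite set. Then for every non-zero complex polynomial of the form $f(z) = \sum_{d \in D} c_d z^d$ (with $c_d \in \mathbb{C}$) we have \[ \alpha(D) \leq \min(\rho_+(f), \rho_-(f)), \] that is, $\alpha(D) \leq \rho(D)$.
   Context: For $n \geq 1$, the circulant graph $G_n$ with set of distances $D$ has vertex set $\{0, \ldots, n-1\}$, and vertices $u, v$ (possibly equal) are adjacent iff there is $d \in D$ with $u - v \equiv d \pmod n$ or $v - u \equiv d \pmod n$ (so loops may occur when $n \leq \max D$). $\alpha(G)$ denotes the maximum size of an independent set, where an independent set contains no two adjacent vertices and no vertex carrying a loop. $\alpha(D) := \lim_{n\to\infty} \alpha(G_n)/n$ (this limit exists and equals $\sup_n \alpha(G_n)/n$). For such a polynomial $f$, $\rho_+(f)$ (resp. $\rho_-(f)$) is the normalized Lebesgue measure (total measure $1$) of the set of $z$ on the unit circle $|z|=1$ with $\operatorname{Re} f(z) > 0$ (resp. $\operatorname{Re} f(z) < 0$). $\rho(D)$ denotes the minimum of $\min(\rho_+(f), \rho_-(f))$ over all non-zero polynomials $f$ of this form. *)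

(* Defs.v *)
From HB Require Import structures.
From mathcomp Require Import all_boot all_order all_algebra.
From mathcomp Require Import all_classical all_reals all_analysis.
From mathcomp.real_closed Require Import complex.
Set Implicit Arguments. Unset Strict Implicit. Unset Printing Implicit Defensive.
Import Order.TTheory GRing.Theory Num.Theory numFieldNormedType.Exports.
Local Open Scope ring_scope.

(* Adjacency in the circulant graph G_n with distance set D on {0,..,n-1}:
   u ~ v iff exists d in D with u - v = d (mod n) or v - u = d (mod n).
   u - v = d (mod n) is written u = v + d (mod n). Loops allowed (u = v). *)
Definition circ_adj (D : seq nat) (n : nat) (u v : 'I_n) : bool :=
  has (fun d => (u == v + d %[mod n]) || (v == u + d %[mod n])) D.

(* independent set: no two (possibly equal) vertices adjacent, hence no loops *)
Definition circ_indep (D : seq nat) (n : nat) (S : {set 'I_n}) : bool :=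
  [forall u in S, forall v in S, ~~ circ_adj D u v].

Definition circ_alpha (D : seq nat) (n : nat) : nat :=
  \max_(S : {set 'I_n} | circ_indep D S) #|S|.

Definition alphaD (R : realType) (D : seq nat) : R :=
  limn (fun n : nat => (circ_alpha D n.+1)%:R / (n.+1)%:R : R).

Definition unit_pt (R : realType) (theta : R) : R[i] :=
  Complex (cos theta) (sin theta).

Definition circle_set (R : realType) (P : R -> Prop) : set R :=
  [set t : R | ((0 <= t) && (t < 2 * pi)) /\ P t].

Definition rho_plus (R : realType) (f : {poly R[i]}) : \bar R :=
  mule ((2 * pi)^-1)%:E
    (@lebesgue_measure R (circle_set (fun t => 0 < complex.Re f.[unit_pt t]))).

Definition rho_minus (R : realType) (f : {poly R[i]}) : \bar R :=
  mule ((2 * pi)^-1)%:E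
    (@lebesgue_measure R (circle_set (fun t => complex.Re f.[unit_pt t] < 0))).

(* Main.v *)
Require Import Defs.
From HB Require Import structures.
From mathcomp Require Import all_boot all_order all_algebra.
From mathcomp Require Import all_classical all_reals all_analysis.
From mathcomp Require Import measurable_realfun ring lra.
From mathcomp.real_closed Require Import complex.
Import Order.TTheory GRing.Theory Num.Theory numFieldNormedType.Exports.
Local Open Scope ring_scope.

(** Let [S] be independent in [G_n], and for an angle [theta] let [z_k] be the [n]
    points [e^(i (theta + 2 pi k / n))].  If [Re f(z_k) <= 0] held for fewer than [#|S|]
    indices [k], some non-zero polynomial [p] of degree [< n] with exponents in [S] would
    vanish at all those [z_k].  But [\sum_k f(z_k) |p(z_k)|^2 = 0], since expanding it
    only produces sums of [z_k^(d + u - v)] with [d] in [D] and [u, v] in [S], and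
    [d + u - v] is never divisible by [n].  Taking real parts, [p] then vanishes at all
    [n] points, which is absurd.  Hence [#|S|] is at most the number of [k] such that
    [Re f(z_k) <= 0]; averaging over [theta] gives [alpha(G_n) / n <= rho_-(f)] for
    every [n], because [Re f] has only finitely many zeros on the circle.  The bound by
    [rho_+(f)] follows by applying this to [- f]. *)

Set Implicit Arguments. Unset Strict Implicit. Unset Printing Implicit Defensive.

(** * Roots of unity and the counting bound at a fixed angle *)

Section Algebra.
Variable C : numClosedFieldType.

Lemma sum_expr_eq0 (q : C) n : q ^+ n = 1 -> q != 1 -> \sum_(k < n) q ^+ k = 0.
Proof.
move=> qn q1; have := subrX1 q n.
by rewrite qn subrr => /esym/eqP; rewrite mulf_eq0 subr_eq0 (negPf q1) => /eqP.
Qed.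

(** As [o] has modulus 1, conjugation inverts it, so each term of the expansion depends on [k] only
    through a power of [o ^+ (d + u) / o ^+ v]. Where the coefficients are non-zero, this ratio is
    an [n]-th root of unity other than 1, and its geometric sum vanishes. *)
Lemma sum_horner_normC_eq0 n (w o : C) (f p : {poly C}) :
  n.-primitive_root o ->
  (size p <= n)%N ->
  (forall d u v, f`_d != 0 -> p`_u != 0 -> p`_v != 0 -> d + u != v %[mod n]) ->
  \sum_(k < n) f.[w * o ^+ k] * `|p.[w * o ^+ k]| ^+ 2 = 0.
Proof.
move=> prim_o sp fp.
have o_unit : `|o| = 1.
  apply/eqP; rewrite -(@pexpr_eq1 _ _ n) ?(prim_order_gt0 prim_o)//.
  by rewrite -normrX (prim_expr_order prim_o) normr1.
have oV : o^* = o^-1 by rewrite invC_norm o_unit expr1n invr1 mul1r.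
have o0 : o != 0 by rewrite -normr_eq0 o_unit oner_eq0.
have -> : \sum_(k < n) f.[w * o ^+ k] * `|p.[w * o ^+ k]| ^+ 2 =
  \sum_(k < n) \sum_(d < size f) \sum_(u < n) \sum_(v < n)
    f`_d * p`_u * (p`_v)^* * (w ^+ d * w ^+ u * (w^*) ^+ v) *
      (o ^+ (d + u) / o ^+ v) ^+ k.
  apply: eq_bigr => k _; rewrite normCK horner_coef (horner_coef_wide _ sp).
  rewrite rmorph_sum /= mulr_suml; apply: eq_bigr => d _.
  rewrite mulr_suml mulr_sumr; apply: eq_bigr => u _.
  rewrite 2!mulr_sumr; apply: eq_bigr => v _.
  rewrite rmorphM !rmorphXn rmorphM rmorphXn /= oV expr_div_n !exprMn exprD exprMn.
  rewrite -!exprVn -!exprM !(mulnC k); ring.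
rewrite exchange_big big1// => d _; rewrite exchange_big big1// => u _.
rewrite exchange_big big1// => v _; rewrite -mulr_sumr.
have [->|fd] := eqVneq f`_d 0; first by rewrite !mul0r.
have [->|pu] := eqVneq p`_u 0; first by rewrite mulr0 !mul0r.
have [->|pv] := eqVneq p`_v 0; first by rewrite conjC0 mulr0 !mul0r.
rewrite sum_expr_eq0 ?mulr0//.
  by rewrite expr_div_n -!exprM !(mulnC _ n) !exprM (prim_expr_order prim_o) !expr1n divr1.
apply: contra (fp d u v fd pu pv) => /eqP oduv.
rewrite -(eq_prim_root_expr prim_o); apply/eqP.
by rewrite -[RHS]mul1r -oduv divfK// expf_neq0.
Qed.

Lemma card_indep_le_Re_le0 n (S : {set 'I_n}) (w o : C) (f : {poly C}) :
  n.-primitive_root o -> w != 0 ->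
  (forall d (u v : 'I_n), f`_d != 0 -> u \in S -> v \in S ->
     d + u != v %[mod n]) ->
  (#|S| <= #|[set k : 'I_n | ('Re f.[w * o ^+ k] <= 0)%R]|)%N.
Proof.
move=> prim_o w0 fS; set K := [set k | _]; rewrite leqNgt; apply/negP => ltKS.
pose z (k : 'I_n) := w * o ^+ k.
have o0 : o != 0.
  apply/eqP => o0; have := prim_expr_order prim_o.
  by rewrite o0 expr0n gtn_eqF ?(prim_order_gt0 prim_o)// => /eqP; rewrite eq_sym oner_eq0.
have z_inj : injective z.
  move=> i j /(mulfI w0) /eqP; rewrite (eq_prim_root_expr prim_o).
  by rewrite !modn_small// => /eqP/val_inj.
(* Each row evaluates one monomial with exponent in [S] at the points indexed by [K]. Having more
   rows than columns, [A] has a non-zero left kernel vector [x], whose entries become the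
   coefficients of [p]. *)
pose A : 'M[C]_(#|S|, #|K|) :=
  \matrix_(i, j) z (enum_val j) ^+ val (enum_val i).
have : kermx A != 0.
  by rewrite -mxrank_eq0 mxrank_ker -lt0n subn_gt0 (leq_ltn_trans (rank_leq_col A)).
case/rowV0Pn => x /sub_kermxP xA x0.
pose p := \sum_(i < #|S|) x 0 i *: 'X^(val (enum_val i)).
have coefp (u : nat) : p`_u = \sum_(i < #|S| | val (enum_val i) == u) x 0 i.
  rewrite coef_sum [RHS]big_mkcond; apply: eq_bigr => i _.
  by rewrite coefZ coefXn eq_sym; case: eqP; rewrite ?mulr1 ?mulr0.
have p_supp u : p`_u != 0 -> exists2 i : 'I_n, i \in S & u = i.
  rewrite coefp => pu; have [i /eqP iu|none] := pickP (fun i : 'I_#|S| => val (enum_val i) == u).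
    by exists (enum_val i) => //; exact: enum_valP.
  by rewrite big_pred0 ?eqxx in pu.
have sp : (size p <= n)%N.
  apply/leq_sizeP => j nj; apply/eqP/contraT => /p_supp [i _ ij].
  by have := ltn_ord i; rewrite -ij ltnNge nj.
have pK k : k \in K -> p.[z k] = 0.
  move=> kK; have /rowP/(_ (enum_rank_in kK k)) := xA.
  rewrite !mxE => <-; rewrite horner_sum; apply: eq_bigr => i _.
  by rewrite hornerZ hornerXn mxE enum_rankK_in.
have p0 : p != 0.
  have /rV0Pn [i xi] := x0; apply: contraNneq xi => p0.
  have := coefp (val (enum_val i)); rewrite p0 coef0 (big_pred1 i); first by move=> <-.
  by move=> j; rewrite /= -[LHS]/(_ == _) (inj_eq val_inj) (inj_eq enum_val_inj).
have zero k : p.[z k] = 0.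
  have [kK|kK] := boolP (k \in K); first exact: pK.
  (* Terms indexed by [K] vanish with [p]; the others carry a factor ['Re f.[z j] > 0]. All being
     non-negative, a zero total makes [p] vanish outside [K] too. *)
  have /(congr1 (fun x : C => 'Re x)) : \sum_(k < n) f.[z k] * `|p.[z k]| ^+ 2 = 0.
    apply: sum_horner_normC_eq0 => // d u v fd /p_supp[i iS ->] /p_supp[j jS ->].
    exact: fS.
  rewrite raddf_sum /= raddf0 => /eqP.
  have ReE (j : 'I_n) : 'Re (f.[z j] * `|p.[z j]| ^+ 2) = 'Re f.[z j] * `|p.[z j]| ^+ 2.
    by rewrite mulrC ReMl 1?mulrC// rpredX// normr_real.
  rewrite psumr_eq0 => [/allP/(_ k)|j _]; rewrite ReE.
    rewrite mem_index_enum => /(_ isT).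
    rewrite mulf_eq0 expf_eq0 /= normr_eq0 => /orP[|/eqP//] Re0.
    by rewrite inE (eqP Re0) lexx in kK.
  have [jK|jK] := boolP (j \in K); first by rewrite pK// normr0 expr0n mulr0.
  rewrite mulr_ge0 ?exprn_ge0//; rewrite inE in jK.
  by rewrite ltW// real_ltNge ?Creal_Re ?real0.
have sz : size (map z (enum 'I_n)) = n by rewrite size_map size_enum_ord.
suff : (n < size p)%N by rewrite ltnNge sp.
rewrite -[X in (X < _)%N]sz; apply: max_poly_roots => //.
  by apply/allP => _ /mapP[k _ ->]; apply/eqP.
by rewrite map_inj_uniq// enum_uniq.
Qed.
End Algebra.

(** * Translation invariance and averaging over the angle *)

Section Measure.
Local Open Scope classical_set_scope.
Local Open Scope ereal_scope.
Variable R : realType.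
Local Notation mu := (@lebesgue_measure R).

(** The type [measurableTypeR R] lets this map carry a measurable-function structure, so that its
    pushforward of [mu] is a measure. *)
Definition translate (a : R) : measurableTypeR R -> measurableTypeR R :=
  fun x => (x + a)%R.

Lemma measurable_translate (a : R) : measurable_fun setT (translate a).
Proof.
by apply: continuous_measurable_fun => x; apply: cvgD; [exact: cvg_id|exact: cvg_cst].
Qed.

HB.instance Definition _ (a : R) :=
  isMeasurableFun.Build _ _ _ _ (translate a) (measurable_translate a).

(** By uniqueness of Lebesgue measure, it suffices that the pushforward gives half-open intervals
    their length. *)
Lemma lebesgue_measure_translate (a : R) (A : set R) : measurable A ->
  mu (translate a @^-1` A) = mu A.
Proof.
move=> mA; apply/esym.
apply: (@lebesgue_measure_unique _ (pushforward mu (translate a))) => // _ [[b c]] _ <-.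
rewrite /= /pushforward.
rewrite (_ : translate a @^-1` _ = `](b - a)%R, (c - a)%R]); last first.
  by apply/seteqP; split => x /=; rewrite /translate !in_itv/= ltrBlDr lerBrDr.
rewrite !lebesgue_measure_itv/= !lte_fin ltrD2r -!EFinB.
by rewrite opprB addrA subrK.
Qed.

Lemma sum_measure_itv (A : set R) (h : R) n : (0 <= h)%R -> measurable A ->
  \sum_(k < n) mu (A `&` `[(h *+ k)%R, (h *+ k.+1)%R[) = mu (A `&` `[0%R, (h *+ n)%R[).
Proof.
move=> h0 mA; elim: n => [|n IHn].
  by rewrite big_ord0 mulr0n set_itvco0 setI0 measure0.
rewrite big_ord_recr /= IHn -measureU//=; first last.
- apply/seteqP; split => // x [[_ /=]] + [_ /=]; rewrite !in_itv/=.
  by move=> /andP[_ xn] /andP[nx _]; move: xn; rewrite ltNge nx.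
- by apply: measurableI.
- by apply: measurableI.
rewrite -setIUr; congr (mu (_ `&` _)); apply/seteqP; split => x /=; rewrite !in_itv/=.
  move=> [/andP[-> xn]|/andP[nx ->]].
    by rewrite (lt_le_trans xn)// ler_wpMn2l.
  by rewrite (le_trans _ nx)// mulrn_wge0.
by move=> /andP[-> ->]; have [|] := ltP x (h *+ n)%R; [left|right].
Qed.

(* Integrating the count over [theta] in [0, h) unfolds into the measure of [A] on [0, n h). *)
Lemma count_translates_le (A : set R) (h : R) n m :
  (0 <= h)%R -> measurable A ->
  (forall theta : R, m <= #|[pred k : 'I_n | (theta + h *+ k)%R \in A]|)%N ->
  (m%:R * h)%:E <= mu (A `&` `[0%R, (h *+ n)%R[).
Proof.
move=> h0 mA hm; rewrite -sum_measure_itv//.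
pose D : set R := `[0%R, h[.
have mD : measurable D by exact: measurable_itv.
have muD : mu D = h%:E.
  rewrite /D lebesgue_measure_itv /= lte_fin -EFinB subr0.
  by case: ltP => // h0'; rewrite (@le_anti _ _ h 0%R) ?h0 ?h0'.
pose B (k : 'I_n) : set R := translate (h *+ k)%R @^-1` A.
have mB k : measurable (B k).
  by rewrite -[B k]setTI; exact: measurable_translate.
have -> : \sum_(k < n) mu (A `&` `[(h *+ k)%R, (h *+ k.+1)%R[) =
    \int[mu]_(x in D) (\sum_(k < n) (\1_(B k) x)%:E).
  rewrite ge0_integral_sum//; last first.
    by move=> k; apply/measurable_EFinP; exact: measurable_indic (mB k).
  apply: eq_bigr => k _; rewrite integral_indic; [|exact: mD|exact: mB].
  (* Pulling the [k]-th window back by [h *+ k] turns it into [D], and [A] into [B k]. *)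
  rewrite -(lebesgue_measure_translate (h *+ k)%R); last exact: measurableI.
  congr (mu _); apply/seteqP.
  by split => x; rewrite /B /D /translate /= !in_itv/= mulrS lerDr ltrD2r.
rewrite [X in X <= _](_ : _ = \int[mu]_(x in D) (cst (m%:R)%:E) x); last first.
  by rewrite integral_cst// EFinM; congr (_ * _); exact/esym.
apply: ge0_le_integral => //.
- by move=> x _; rewrite lee_fin.
- apply: emeasurable_sum => k.
  by apply/measurable_EFinP; exact: measurable_indic (mB k).
- move=> x _; rewrite /cst sumEFin lee_fin.
  under eq_bigr do rewrite indicE.
  rewrite -natr_sum ler_nat (leq_trans (hm x))// -sum1_card big_mkcond /=.
  apply: leq_sum => k _; rewrite inE.
  have -> : (x \in B k) = ((x + h *+ k)%R \in A) by apply/idP/idP; rewrite !inE.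
  by case: (_ \in _).
Qed.
End Measure.

(** * The unit circle and the zeros of the real part on it *)

Section Circle.
Variable R : realType.
Local Notation expi := (@unit_pt R).

Lemma unit_ptD (s t : R) : expi (s + t) = expi s * expi t.
Proof. by rewrite /unit_pt sinD cosD; congr Complex; rewrite addrC. Qed.

Lemma unit_pt0 : expi 0 = 1.
Proof. by rewrite /unit_pt cos0 sin0. Qed.

Lemma unit_ptMn (t : R) n : expi (t *+ n) = expi t ^+ n.
Proof.
by elim: n => [|n IHn]; rewrite ?mulr0n ?unit_pt0// mulrS unit_ptD IHn exprS.
Qed.

Lemma unit_pt2pi : expi (2 * pi) = 1.
Proof. by rewrite /unit_pt mulr_natl cos2pi sin2pi. Qed.

Lemma unit_pt_neq0 (t : R) : expi t != 0.
Proof.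
have := unit_ptD t (- t); rewrite subrr unit_pt0 => /eqP.
by apply: contraTneq => ->; rewrite mul0r oner_eq0.
Qed.

Lemma conjc_unit_pt (t : R) : conjc (expi t) = (expi t)^-1.
Proof.
apply: (mulfI (unit_pt_neq0 t)); rewrite divff ?unit_pt_neq0//.
have -> : conjc (expi t) = expi (- t) by rewrite /unit_pt cosN sinN.
by rewrite -unit_ptD subrr unit_pt0.
Qed.

Lemma unit_pt_neq1 (t : R) : 0 < t < 2 * pi -> expi t != 1.
Proof.
move=> /andP[t0 t2]; apply/eqP => /(congr1 (@complex.Re R)) /= cos1.
(* The half-angle formula [cos t = 1 - 2 sin(t/2)^2] applies, with [t / 2] strictly between [0] and
   [pi]. *)
have := cos_mulr2n (t / 2); rewrite (_ : t / 2 *+ 2 = t); last by rewrite -mulr_natr divfK.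
rewrite cos1 cos2sin2.
have : 0 < sin (t / 2) by apply: sin_gt0_pi; lra.
nra.
Qed.

Lemma unit_pt_inj : {in [pred t : R | 0 <= t < 2 * pi] &, injective expi}.
Proof.
have unit_pt_neq_lt s t : 0 <= s -> t < 2 * pi -> s < t -> expi s <> expi t.
  move=> s0 t2 st; rewrite -[t](subrKC s) unit_ptD -[LHS]mulr1.
  move=> /(mulfI (unit_pt_neq0 _))/esym/eqP.
  by apply/negP/unit_pt_neq1; lra.
move=> s t /andP[s0 s2] /andP[t0 t2] st.
by case: (ltgtP s t) => // [/(unit_pt_neq_lt _ _ s0 t2)|/(unit_pt_neq_lt _ _ t0 s2)/nesym].
Qed.

Lemma unit_pt_prim_root n : (0 < n)%N -> n.-primitive_root (expi (2 * pi / n%:R)).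
Proof.
move=> n0; have n0R : 0 < n%:R :> R by rewrite ltr0n.
(* Primitivity is tested on the exponents [i.+1] with [i < n]: the last one gives a full turn, the
   others an angle strictly between [0] and [2 * pi]. *)
apply/andP; split=> //; apply/forallP => i; apply/eqP.
rewrite unity_rootE -unit_ptMn; have := ltn_ord i; rewrite leq_eqVlt => /orP[/eqP ->|i_n].
  by rewrite -[(_ / _) *+ _]mulr_natr divfK ?(gt_eqF n0R)// unit_pt2pi !eqxx.
rewrite (ltn_eqF i_n); apply/negbTE/unit_pt_neq1.
have tau0 : 0 < 2 * pi :> R by rewrite mulr_gt0 ?pi_gt0.
rewrite -[(_ / _) *+ _]mulr_natr mulrAC; apply/andP; split.
  by rewrite divr_gt0// mulr_gt0// ltr0n.
by rewrite ltr_pdivrMr// ltr_pM2l// ltr_nat.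
Qed.

Definition re_circle (f : {poly R[i]}) (t : R) : R := complex.Re f.[expi t].

Lemma re_circleE f t : re_circle f t =
  \sum_(d < size f) (complex.Re f`_d * cos (t *+ d) - complex.Im f`_d * sin (t *+ d)).
Proof.
rewrite /re_circle horner_coef.
rewrite (raddf_sum (@complex.Re R : {additive Rcomplex R -> R})); apply: eq_bigr => d _.
by rewrite -unit_ptMn; case: (f`_d).
Qed.

Lemma measurable_re_circle f : measurable_fun setT (re_circle f).
Proof.
rewrite (_ : re_circle f = fun t => \sum_(d < size f)
  (complex.Re f`_d * cos (t *+ d) - complex.Im f`_d * sin (t *+ d))); last first.
  by apply/funext => t; rewrite re_circleE.
apply: measurable_sum => d; apply: measurable_funB; apply: measurable_funM => //.
  apply: continuous_measurable_fun => t; apply: continuous_comp; last exact: continuous_cos.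
  exact: natmul_continuous.
apply: continuous_measurable_fun => t; apply: continuous_comp; last exact: continuous_sin.
exact: natmul_continuous.
Qed.

(** The zeros are finitely many, being roots of a non-zero polynomial. A zero constant term rules
    out an imaginary constant [f], whose real part vanishes everywhere. *)
Lemma re_circle_null (f : {poly R[i]}) : f != 0 -> f`_0 = 0 ->
  lebesgue_measure (circle_set (fun t => re_circle f t = 0)) = 0%E.
Proof.
move=> fn0 f0; apply: countable_lebesgue_measure0; apply: finite_set_countable.
pose N := size f.
have sf1 : (1 < N)%N.
  rewrite ltnNge; apply: contra fn0 => /size1_polyC ->.
  by rewrite f0 polyC0.
(* On the unit circle [q(z) = z^N (f(z) + conj f(z)) = 2 z^N Re f(z)]. *)
pose q := f * 'X^N + \sum_(d < N) conjc f`_d *: 'X^(N - d).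
have q0 : q != 0.
  (* At degree [N + N.-1] the first summand has the leading coefficient of [f], while the second has
     degree at most [N], which is smaller since [1 < N]. *)
  apply/eqP => /(congr1 (fun p : {poly R[i]} => p`_(N + N.-1))).
  rewrite coef0 coefD coefMXn ltnNge leq_addr /= addKn coef_sum big1 ?addr0.
    by apply/eqP; rewrite -lead_coefE lead_coef_eq0.
  move=> d _; rewrite coefZ coefXn gtn_eqF ?mulr0//.
  by rewrite (leq_ltn_trans (leq_subr _ _))// -[ltnLHS]addn0 ltn_add2l; case: (N) sf1 => [|[]].
have qE t : q.[expi t] = expi t ^+ N * (2 * (re_circle f t)%:C)%C.
  rewrite -addcJ hornerD hornerM hornerXn mulrDr mulrC; congr (_ + _).
  rewrite [in RHS]horner_coef rmorph_sum mulr_sumr horner_sum /=.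
  apply: eq_bigr => d _; rewrite hornerZ hornerXn rmorphM rmorphXn /=.
  rewrite -[(_ -i* _)%C]/(conjc (expi t)) conjc_unit_pt exprVn mulrCA; congr (_ * _).
  by rewrite -expfB_cond// (negPf (unit_pt_neq0 t)) add0n ltnW.
have [r qr] := closed_field_poly_normal q.
set Z := circle_set _; have injZ : {in Z &, injective expi}.
  by move=> s t /set_mem[s02 _] /set_mem[t02 _]; exact: unit_pt_inj.
rewrite -(eq_finite_set (inj_card_eq injZ)).
apply: (@sub_finite_set _ _ [set` r]%classic) => // _ [t [t02 ft0]] <- /=.
have : root q (expi t) by rewrite /root qE ft0 !mulr0.
by rewrite qr rootZ ?lead_coef_eq0// root_prod_XsubC.
Qed.
End Circle.

(** * From the finite graphs to the limit *)

Section Bound.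
Local Open Scope classical_set_scope.
Variable R : realType.
Local Notation mu := (@lebesgue_measure R).

(* Nonnegativity handles a divergent [u], for which [limn u] is the junk value [0]. *)
Lemma limn_le_ereal (u : R^nat) (x : \bar R) :
  (forall n, 0 <= u n) -> (forall n, ((u n)%:E <= x)%E) -> ((limn u)%:E <= x)%E.
Proof.
move=> u0 ux; have [cu|/dvgP ->] := pselect (cvgn u); last first.
  by apply: le_trans (ux 0%N); rewrite lee_fin.
case: x ux => [r| |] ux; [|exact: leey|by have := ux 0%N].
by rewrite lee_fin; apply: limr_le => //; apply: nearW => n; rewrite -lee_fin.
Qed.

Lemma circ_alpha_le (D : seq nat) (f : {poly R[i]}) n (theta : R) :
  (0 < n)%N -> (forall k, f`_k != 0 -> k \in D) ->
  (circ_alpha D n <=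
   #|[pred k : 'I_n | (re_circle f (theta + (2 * pi / n%:R) *+ k) <= 0)%R]|)%N.
Proof.
move=> n0 fD; apply/bigmax_leqP => S indepS.
have fS d (u v : 'I_n) : f`_d != 0 -> u \in S -> v \in S -> d + u != v %[mod n].
  move=> /fD dD uS vS; move: indepS => /forall_inP/(_ u uS)/forall_inP/(_ v vS).
  by move=> /hasPn/(_ d dD); rewrite negb_or (addnC u) => /andP[_]; rewrite eq_sym.
apply: leq_trans (card_indep_le_Re_le0 (unit_pt_prim_root R n0) (unit_pt_neq0 theta) fS) _.
apply: subset_leq_card; apply/fintype.subsetP => k; rewrite !inE.
by rewrite -unit_ptMn -unit_ptD -complexRe lecR.
Qed.

Lemma circ_alpha_le_rho_minus (D : seq nat) (f : {poly R[i]}) n :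
  f != 0 -> f`_0 = 0 -> (forall k, f`_k != 0 -> k \in D) ->
  (((circ_alpha D n.+1)%:R / n.+1%:R)%:E <= rho_minus f)%E.
Proof.
move=> fn0 f0 fD; have tau0 : 0 < 2 * pi :> R by rewrite mulr_gt0 ?pi_gt0.
have circleE (P : set R) :
    circle_set (fun t => P (re_circle f t)) = `[0, 2 * pi[ `&` re_circle f @^-1` P.
  by apply/seteqP; split => t []; rewrite /= in_itv.
have mpre (P : set R) : measurable P -> measurable (re_circle f @^-1` P).
  by move=> mP; rewrite -[X in measurable X]setTI; exact: measurable_re_circle.
have mcircle (P : set R) : measurable P ->
    measurable (circle_set (fun t => P (re_circle f t))).
  by move=> mP; rewrite circleE; apply: measurableI => //; exact: mpre.
(* The half-line is closed because the count at each angle concerns [Re f <= 0]; the zeros are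
   discarded at the end as a null set. *)
pose N : set R := `]-oo, 0].
have bound : (((circ_alpha D n.+1)%:R * (2 * pi / n.+1%:R))%:E <=
    mu (circle_set (fun t => N (re_circle f t))))%E.
  have -> : circle_set (fun t => N (re_circle f t)) =
      re_circle f @^-1` N `&` `[0, (2 * pi / n.+1%:R) *+ n.+1[.
    by rewrite circleE setIC -[(_ / _) *+ _]mulr_natr divfK ?pnatr_eq0.
  apply: count_translates_le => [||theta]; first by rewrite divr_ge0// ltW.
    by apply: mpre; exact: measurable_itv.
  apply: leq_trans (circ_alpha_le theta _ fD) _ => //.
  apply: subset_leq_card; apply/fintype.subsetP => k; rewrite !inE => ?.
  by rewrite /N /= in_itv.
rewrite /rho_minus lee_pdivlMl// -EFinM mulrC mulrAC -mulrA.
apply: le_trans bound _.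
have mLt : measurable (circle_set (fun t => re_circle f t < 0)).
  by apply: (mcircle [set x | x < 0]); rewrite -set_itvNyo; exact: measurable_itv.
have mZ : measurable (circle_set (fun t => re_circle f t = 0)).
  by apply: (mcircle [set 0]); exact: measurable_set1.
rewrite -[leRHS]adde0 -(re_circle_null fn0 f0).
apply: le_trans (measureU2 mu mLt mZ).
apply: le_measure; rewrite ?inE.
- by apply: mcircle; exact: measurable_itv.
- exact: measurableU.
- by move=> t [t02]; rewrite /N /= in_itv/= le_eqVlt => /orP[/eqP|] ft; [right|left]; split.
Qed.

Lemma alphaD_le_rho_minus (D : seq nat) (f : {poly R[i]}) :
  f != 0 -> f`_0 = 0 -> (forall k, f`_k != 0 -> k \in D) ->
  ((alphaD R D)%:E <= rho_minus f)%E.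
Proof.
move=> fn0 f0 fD; apply: limn_le_ereal => n; first by rewrite divr_ge0.
exact: circ_alpha_le_rho_minus.
Qed.

Lemma rho_minusN (f : {poly R[i]}) : rho_minus (- f) = rho_plus f.
Proof.
rewrite /rho_minus /rho_plus; congr (_ * mu (circle_set _))%E.
apply/funext => t; rewrite hornerN.
by rewrite (raddfN (@complex.Re R : {additive Rcomplex R -> R})) oppr_lt0.
Qed.
End Bound.

Theorem theorem2 (R : realType) (D : seq nat) (f : {poly R[i]}) :
  all (fun d => 0 < d)%N D ->
  f != 0 ->
  (forall k : nat, f`_k != 0 -> k \in D) ->
  ((alphaD R D)%:E <= Order.min (rho_plus f) (rho_minus f))%E.
Proof.
move=> /allP D0 fn0 fD.
(* Positive distances leave no constant term, as [re_circle_null] requires. *)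
have f0 : f`_0 = 0 by apply/eqP; apply: contraT => /fD/D0.
rewrite le_min -rho_minusN !alphaD_le_rho_minus ?oppr_eq0 ?coefN ?f0 ?oppr0//.
by move=> k; rewrite coefN oppr_eq0; exact: fD.
Qed.
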